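(* Let $R$ be a 2-primal ring. If $R$ is strongly 2-nil-clean, then the matrix ring $M_n(R)$ is 2-nil-clean for all $n\in\mathbb{N}$.
   Context: All rings are associative with identity (not necessarily commutative). $\mathbb{N}$ denotes the set of natural numbers (positive integers), and $M_n(R)$ is the ring of $n\times n$ matrices over $R$. A ring $R$ is 2-nil-clean if every element of $R$ can be written as $e+f+w$ with $e,f\in R$ idempotent and $w\in R$ nilpotent. It is strongly 2-nil-clean if every element can be written in this form with $e,f,w$ pairwise commuting. The prime radical $P(R)$ is the intersection of all prime ideals of $R$. A ring $R$ is 2-primal if $P(R)$ coincides with the set of nilpotent elements of $R$. *)

(* Defs.v *)
From HB Require Import structures.
From mathcomp Require Import all_boot all_order all_algebra.
From mathcomp Require Import boolp classical_sets.

Set Implicit Arguments.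
Unset Strict Implicit.
Unset Printing Implicit Defensive.

Import GRing.Theory.

Local Open Scope classical_set_scope.
Local Open Scope ring_scope.

(* Rings are pzRingType: associative, unital, not necessarily commutative,
   with the zero ring allowed. *)

Definition idempotent_elt (R : pzRingType) (e : R) : Prop := e * e = e.

Definition nilpotent_elt (R : pzRingType) (w : R) : Prop :=
  exists k : nat, w ^+ k = 0.

Definition two_nil_clean (R : pzRingType) : Prop :=
  forall a : R, exists e f w : R,
    [/\ idempotent_elt e, idempotent_elt f, nilpotent_elt w & a = e + f + w].

Definition strongly_two_nil_clean (R : pzRingType) : Prop :=
  forall a : R, exists e f w : R,
    [/\ idempotent_elt e, idempotent_elt f, nilpotent_elt w & a = e + f + w]
    /\ [/\ GRing.comm e f, GRing.comm e w & GRing.comm f w].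

(* MathComp's idealr and prime_idealr are one-sided and completely prime
   respectively, hence the definitions below for noncommutative rings. *)
Definition two_sided_ideal (R : pzRingType) (I : set R) : Prop :=
  [/\ I 0,
      forall x y, I x -> I y -> I (x - y)
    & forall r x, I x -> I (r * x) /\ I (x * r)].

(* The ideal product AB consists of the finite sums of products a * b; as P is
   additively closed, AB is included in P iff every a * b is in P. *)
Definition prime_ideal (R : pzRingType) (P : set R) : Prop :=
  [/\ two_sided_ideal P,
      P <> setT
    & forall A B : set R, two_sided_ideal A -> two_sided_ideal B ->
        [set a * b | a in A & b in B] `<=` P -> A `<=` P \/ B `<=` P].

Definition prime_radical (R : pzRingType) : set R :=
  \bigcap_(P in @prime_ideal R) P.

Arguments prime_radical : clear implicits.

Definition two_primal (R : pzRingType) : Prop :=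
  prime_radical R = [set x : R | nilpotent_elt x].

(* Main.v *)
From HB Require Import structures.
Require Import Defs.
From mathcomp Require Import all_boot all_order all_algebra.
From mathcomp Require Import boolp classical_sets.

(** Let N be the set of nilpotent elements of R. As R is 2-primal, N is the
    prime radical, hence a two-sided ideal, and T = R / N is a reduced ring in
    which every element is a sum of two idempotents. The problem is solved for
    matrices over T and then lifted to R.

    Lifting. The kernel of M_n(R) -> M_n(T) consists of the matrices with
    entries in the prime radical, and such a matrix W is nilpotent
    ([nilpotent_mx_prime_radical]): otherwise an ideal I of R that is maximal
    among those for which no power of W has all its entries in I would be
    prime, so it would contain the entries of W itself. Idempotents lift along
    a surjection with nil kernel, and nilpotency is reflected by it
    ([two_nil_clean_lift]).

    Matrices over T. In a reduced ring idempotents are central, and a central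
    idempotent c splits the problem into the one for c A and the one for
    (1 - c) A, in each of which A may be replaced by any matrix having the same
    multiple by c, resp. by 1 - c ([two_nil_clean_elt_split]). Splitting along
    the two idempotents whose sum is a given entry turns this entry into one of
    the integers 0, 1, 2; after finitely many steps the matrix has integer
    entries. Moreover 6 = 0 in T, so that 3 is an idempotent with complement
    -2 = 4, and a last splitting leaves integer matrices modulo 2 and modulo 3.

    Matrices over F_2 and F_3. A Krylov-like chain of vectors shows that every
    matrix is similar to a block lower triangular one whose diagonal blocks
    are bordered matrices [[c, r], [s, S]] with S strictly lower triangular.
    When c is 1 or 2, the idempotent [[1, r], [0, 0]] removes the row r, the
    idempotent [[c - 1, 0], [0, 0]] what is left of c, and the rest is strictly
    lower triangular. When c = 0 and s = 0 the matrix is nilpotent. When c = 0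
    and s != 0 a change of basis moves -1, which is 1 or 2, to the place of c,
    at the price of a single 1 on the diagonal of S, which the second
    idempotent absorbs. *)

Set Implicit Arguments.
Unset Strict Implicit.
Unset Printing Implicit Defensive.

Import GRing.Theory.

Local Open Scope classical_set_scope.
Local Open Scope ring_scope.

(** * Elements that are two idempotents plus a nilpotent *)

Definition two_nil_clean_elt (R : pzRingType) (a : R) : Prop :=
  exists e f w : R,
    [/\ idempotent_elt e, idempotent_elt f, nilpotent_elt w & a = e + f + w].

Lemma idempotent_elt0 (R : pzRingType) : idempotent_elt (0 : R).
Proof. exact: mulr0. Qed.

Lemma idempotent_elt1 (R : pzRingType) : idempotent_elt (1 : R).
Proof. exact: mulr1. Qed.

Lemma idempotent_eltC (R : pzRingType) (e : R) :
  idempotent_elt e -> idempotent_elt (1 - e).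
Proof.
by move=> ee; rewrite /idempotent_elt mulrBl mul1r mulrBr mulr1 ee subrr subr0.
Qed.

Lemma nilpotent_elt0 (R : pzRingType) : nilpotent_elt (0 : R).
Proof. by exists 1%N; rewrite expr1. Qed.

Lemma nilpotent_exprW (R : pzRingType) (x : R) k l :
  (k <= l)%N -> x ^+ k = 0 -> x ^+ l = 0.
Proof. by move=> /subnKC <- xk; rewrite exprD xk mul0r. Qed.

(** The morphisms are not required to preserve 1, so that decompositions can be
    transported from F_p to the part of a ring where p = 0, whose unit is an
    idempotent of that ring. *)
Section NonUnitalMorphism.
Variables (R S : pzRingType) (h : R -> S).
Hypotheses (hD : {morph h : x y / x + y}) (hM : {morph h : x y / x * y}).

Lemma idempotent_elt_morph e : idempotent_elt e -> idempotent_elt (h e).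
Proof. by rewrite /idempotent_elt -hM => ->. Qed.

Lemma nilpotent_elt_morph w : nilpotent_elt w -> nilpotent_elt (h w).
Proof.
have h0 : h 0 = 0 by apply: (addrI (h 0)); rewrite -hD !addr0.
have hX k : h (w ^+ k.+1) = h w ^+ k.+1.
  by elim: k => [|k IHk]; rewrite ?expr1 // exprS hM IHk -exprS.
by case=> k wk; exists k.+1; rewrite -hX exprS wk mulr0.
Qed.

Lemma two_nil_clean_elt_morph a :
  two_nil_clean_elt a -> two_nil_clean_elt (h a).
Proof.
move=> [e [f [w [ee ff ww ->]]]]; exists (h e), (h f), (h w).
by split; [exact: idempotent_elt_morph | exact: idempotent_elt_morph
  | exact: nilpotent_elt_morph | rewrite !hD].
Qed.

End NonUnitalMorphism.

Section CentralSplitting.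
Variables (S : pzRingType) (c : S).
Hypotheses (cc : idempotent_elt c) (cC : forall x, GRing.comm c x).

(** S is the direct product of c S and (1 - c) S; this is the element with the
    first component of x and the second one of y. *)
Let glue x y := c * x + (1 - c) * y.

Let glueD x y x' y' : glue x y + glue x' y' = glue (x + x') (y + y').
Proof. by rewrite /glue !mulrDr addrACA. Qed.

Let glueM x y x' y' : glue x y * glue x' y' = glue (x * x') (y * y').
Proof.
have part d z z' : idempotent_elt d -> GRing.comm d z ->
    d * z * (d * z') = d * (z * z').
  by move=> dd dz; rewrite -(mulrA d z) (mulrA z) -dz !mulrA dd.
have cross d d' z z' : d * d' = 0 -> GRing.comm d' z -> d * z * (d' * z') = 0.
  by move=> dd' dz; rewrite -(mulrA d z) (mulrA z) -dz !mulrA dd' !mul0r.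
have c1C z : GRing.comm (1 - c) z.
  by apply/commr_sym/commrB; [exact: commr1 | exact/commr_sym].
rewrite /glue mulrDl !mulrDr !part //; last exact: idempotent_eltC.
by rewrite !cross ?addr0 ?add0r // ?mulrBl ?mulrBr ?mul1r ?mulr1 cc subrr.
Qed.

Let glue_id x : glue x x = x.
Proof. by rewrite /glue -mulrDl addrC subrK mul1r. Qed.

Lemma two_nil_clean_elt_split a a1 a2 :
    c * a = c * a1 -> (1 - c) * a = (1 - c) * a2 ->
  two_nil_clean_elt a1 -> two_nil_clean_elt a2 -> two_nil_clean_elt a.
Proof.
move=> ac1 ac2 [e1 [f1 [w1 [ee1 ff1 [k1 wk1] Da1]]]].
move=> [e2 [f2 [w2 [ee2 ff2 [k2 wk2] Da2]]]].
exists (glue e1 e2), (glue f1 f2), (glue w1 w2); split.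
- by rewrite /idempotent_elt glueM ee1 ee2.
- by rewrite /idempotent_elt glueM ff1 ff2.
- exists (k1 + k2)%N.
  have -> k : glue w1 w2 ^+ k = glue (w1 ^+ k) (w2 ^+ k).
    by elim: k => [|k IHk]; rewrite ?glue_id // !exprS IHk glueM.
  rewrite (nilpotent_exprW (leq_addr _ _) wk1).
  rewrite (nilpotent_exprW (leq_addl _ _) wk2).
  exact: glue_id.
- by rewrite !glueD -Da1 -Da2 /glue -ac1 -ac2 -/(glue a a) glue_id.
Qed.

End CentralSplitting.

Section NilKernel.
Variables (S T : pzRingType) (h : {rmorphism S -> T}).
Hypothesis ker_nil : forall x, h x = 0 -> nilpotent_elt x.

Lemma lift_nilpotent x : nilpotent_elt (h x) -> nilpotent_elt x.
Proof.
case=> k hxk; case: (ker_nil (x := x ^+ k)); first by rewrite rmorphXn.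
by move=> l xkl; exists (k * l)%N; rewrite exprM.
Qed.

(** The polynomial (1 - (1 - X)^k)^k is divisible by X^k and congruent to 1
    modulo (1 - X)^k. Its value e at x therefore satisfies e (1 - e) = 0 as
    soon as (x (1 - x))^k = 0, whereas it fixes every idempotent. *)
Lemma lift_idempotent x : idempotent_elt (h x) ->
  exists2 e, idempotent_elt e & h e = h x.
Proof.
move=> hxx; pose z := 1 - x.
have idemX (y : T) k : idempotent_elt y -> y ^+ k.+1 = y.
  by move=> yy; elim: k => [|k IHk]; rewrite ?expr1 // exprS IHk.
have zx : x * z = z * x by rewrite /z mulrBl mulrBr mul1r mulr1.
have [k xzk]: nilpotent_elt (x * z).
  by apply: ker_nil; rewrite rmorphM rmorphB rmorph1 mulrBr mulr1 hxx subrr.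
have {}xzk : x ^+ k.+1 * z ^+ k.+1 = 0.
  by rewrite -exprMn_comm // exprSr xzk mul0r.
pose y := 1 - z ^+ k.+1; pose e := y ^+ k.+1.
(* y is divisible by 1 - z = x, and 1 - y ^+ k.+1 is divisible by
   1 - y = z ^+ k.+1, so e * (1 - e) is a multiple of x ^+ k.+1 * z ^+ k.+1. *)
exists e; last first.
  have hz : idempotent_elt (h z).
    by rewrite rmorphB rmorph1; exact: idempotent_eltC.
  rewrite /e /y rmorphXn rmorphB rmorph1 rmorphXn (idemX _ _ hz).
  by rewrite idemX; [rewrite rmorphB rmorph1 subKr | exact: idempotent_eltC].
have comm_z w : GRing.comm x w -> GRing.comm z w.
  by move=> xw; apply/commr_sym/commrB; [exact: commr1 | exact/commr_sym].
pose s := \sum_(i < k.+1) z ^+ i.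
have xs : GRing.comm x s.
  by apply: commr_sum => i _; apply: commrX.
have yE : y = x * s.
  apply: (@oppr_inj S); rewrite /y opprB subrX1 -mulNr /s; congr (_ * _).
  by rewrite /z addrAC subrr add0r.
have eE : e = s ^+ k.+1 * x ^+ k.+1.
  by rewrite /e yE xs exprMn_comm //; exact: commr_sym.
pose v := \sum_(i < k.+1) y ^+ i.
have fE : 1 - e = z ^+ k.+1 * v.
  apply: (@oppr_inj S); rewrite opprB subrX1 -mulNr /v; congr (_ * _).
  by rewrite /y addrAC subrr add0r.
have ef0 : e * (1 - e) = 0.
  by rewrite fE eE -mulrA (mulrA (x ^+ _)) xzk mul0r mulr0.
by apply/eqP; rewrite /idempotent_elt eq_sym -subr_eq0 -{1}[e]mulr1 -mulrBr ef0.
Qed.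

Lemma two_nil_clean_lift (h_surj : forall t, exists x, h x = t) :
  two_nil_clean T -> two_nil_clean S.
Proof.
move=> T_clean a; have [e' [f' [w' [ee ff ww ha]]]] := T_clean (h a).
have lift t : idempotent_elt t -> exists2 e, idempotent_elt e & h e = t.
  by have [x <-] := h_surj t; exact: lift_idempotent.
have [[e eI he] [f fI hf]] := (lift _ ee, lift _ ff).
exists e, f, (a - (e + f)); split=> //; last by rewrite addrC subrK.
by apply: lift_nilpotent; rewrite rmorphB rmorphD he hf ha addrAC subrr add0r.
Qed.

End NilKernel.

(** * Block matrices *)

Lemma two_nil_clean_elt_nilpotent (R : pzRingType) (a : R) :
  nilpotent_elt a -> two_nil_clean_elt a.
Proof.
move=> aN; exists 0, 0, a.
by split=> //; rewrite ?addr0 ?add0r //; exact: idempotent_elt0.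
Qed.

Section Blocks.
Variable R : pzRingType.

Lemma nilpotent_block_lower m n (A : 'M[R]_m) (X : 'M_(n, m)) (D : 'M_n) :
  nilpotent_elt A -> nilpotent_elt D -> nilpotent_elt (block_mx A 0 X D).
Proof.
move=> [k Ak] [l Dl]; exists ((k + l) * 2)%N.
(* The power k + l kills both diagonal blocks; what remains squares to 0. *)
have powE i : exists Y, block_mx A 0 X D ^+ i = block_mx (A ^+ i) 0 Y (D ^+ i).
  elim: i => [|i [Y IHi]]; first by exists 0; rewrite !expr0 -scalar_mx_block.
  exists (X *m A ^+ i + D *m Y); rewrite !exprS IHi -mulmxE mulmx_block.
  by rewrite !mulmx0 !mul0mx !addr0 add0r.
have [Y powY] := powE (k + l)%N.
rewrite exprM powY (nilpotent_exprW (leq_addr _ _) Ak).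
rewrite (nilpotent_exprW (leq_addl _ _) Dl) expr2 -mulmxE mulmx_block.
by rewrite !mulmx0 !mul0mx !addr0 block_mx0.
Qed.

Lemma idempotent_block_diag m n (A : 'M[R]_m) (D : 'M_n) :
  idempotent_elt A -> idempotent_elt D -> idempotent_elt (block_mx A 0 0 D).
Proof.
move=> AA DD; rewrite /idempotent_elt -mulmxE mulmx_block.
by rewrite !mulmx0 !mul0mx !addr0 add0r !mulmxE AA DD.
Qed.

Lemma two_nil_clean_elt_block_lower m n (A : 'M[R]_m) (X : 'M_(n, m))
    (D : 'M_n) :
  two_nil_clean_elt A -> two_nil_clean_elt D ->
  two_nil_clean_elt (block_mx A 0 X D).
Proof.
move=> [e1 [f1 [w1 [ee1 ff1 ww1 ->]]]] [e2 [f2 [w2 [ee2 ff2 ww2 ->]]]].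
exists (block_mx e1 0 0 e2), (block_mx f1 0 0 f2), (block_mx w1 0 X w2); split.
- exact: idempotent_block_diag.
- exact: idempotent_block_diag.
- exact: nilpotent_block_lower.
- by rewrite !add_block_mx !addr0 add0r.
Qed.

(** P may relate matrices of formally different sizes, which spares casts
    along m + (n - m) = n when a basis is completed. *)
Lemma two_nil_clean_elt_similar m n (P : 'M[R]_(m, n)) (Q : 'M_(n, m))
    (A : 'M_n) :
  P *m Q = 1%:M -> Q *m P = 1%:M ->
  two_nil_clean_elt (P *m A *m Q) -> two_nil_clean_elt A.
Proof.
move=> PQ QP /(two_nil_clean_elt_morph (h := fun X => Q *m X *m P)).
rewrite !mulmxA QP mul1mx -mulmxA QP mulmx1; apply=> X Y.
  by rewrite mulmxDr mulmxDl.
by rewrite -!mulmxE !mulmxA -(mulmxA _ P Q) PQ mulmx1.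
Qed.

Lemma two_nil_clean_elt_block_upper m n (A : 'M[R]_m) (X : 'M_(m, n))
    (D : 'M_n) :
  two_nil_clean_elt A -> two_nil_clean_elt D ->
  two_nil_clean_elt (block_mx A X 0 D).
Proof.
move=> A_clean D_clean; pose P := block_mx 0 1%:M 1%:M 0 : 'M[R]_(n + m, m + n).
pose Q := block_mx 0 1%:M 1%:M 0 : 'M[R]_(m + n, n + m).
apply: (@two_nil_clean_elt_similar _ _ P Q).
- rewrite mulmx_block !(mulmx0, mul0mx, mulmx1, addr0, add0r).
  by rewrite -scalar_mx_block.
- rewrite mulmx_block !(mulmx0, mul0mx, mulmx1, addr0, add0r).
  by rewrite -scalar_mx_block.
rewrite !mulmx_block !(mulmx0, mul0mx, mulmx1, mul1mx, addr0, add0r).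
exact: two_nil_clean_elt_block_lower.
Qed.

Definition strictly_lower n (S : 'M[R]_n) : Prop :=
  forall i j : 'I_n, (i <= j)%N -> S i j = 0.

Lemma nilpotent_strictly_lower n (S : 'M[R]_n) :
  strictly_lower S -> nilpotent_elt S.
Proof.
rewrite /strictly_lower; elim: n S => [|n IHn] S Slow.
  by exists 0%N; exact: flatmx0.
rewrite -[S](@submxK _ 1 n 1 n).
have -> : @ursubmx _ 1 n 1 n S = 0.
  by apply/matrixP=> i j; rewrite !mxE Slow // ord1.
apply: (@nilpotent_block_lower 1 n).
  exists 1%N; rewrite expr1; apply/matrixP=> i j.
  by rewrite !mxE Slow // !ord1.
by apply: IHn => i j le_ij; rewrite !mxE Slow.
Qed.

(** Explicitly, the summands are the idempotents [[1, r], [0, 0]] and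
    [[d, 0], [0, G]], and the strictly lower triangular [[0, 0], [s, U - G]]. *)
Lemma two_nil_clean_elt_bordered n (d : 'M[R]_1) (r : 'rV_n) (s : 'cV_n)
    (U G : 'M_n) :
    idempotent_elt d -> idempotent_elt G -> strictly_lower (U - G) ->
  two_nil_clean_elt (block_mx (1 + d) r s U).
Proof.
move=> dd GG UG; exists (block_mx 1 r 0 0), (block_mx d 0 0 G),
  (block_mx 0 0 s (U - G)); split.
- rewrite /idempotent_elt -mulmxE mulmx_block.
  by rewrite !(mulmx0, mul0mx, addr0) mulmx1 mul1mx.
- exact: idempotent_block_diag.
- apply: nilpotent_block_lower; first exact: nilpotent_elt0.
  exact: nilpotent_strictly_lower.
- by rewrite !add_block_mx !(addr0, add0r) (addrC G) subrK.
Qed.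

End Blocks.

(** * Matrices over the fields with two and three elements *)

Section SmallField.
Variable F : fieldType.
Hypothesis F012 : forall c : F, [\/ c = 0, c = 1 | c = 1 + 1].

Lemma small_shift (c : 'M[F]_1) :
  c != 0 -> exists2 d, idempotent_elt d & c = 1 + d.
Proof.
move=> c0; have [c00|c1|c2] := F012 (c 0 0).
- by case/eqP: c0; apply/matrixP=> i j; rewrite !ord1 c00 mxE.
- exists 0; first exact: idempotent_elt0.
  by apply/matrixP=> i j; rewrite !ord1 c1 !mxE addr0.
- exists 1; first exact: idempotent_elt1.
  by apply/matrixP=> i j; rewrite !ord1 c2 !mxE.
Qed.

(** The delicate case is c = 0 and s != 0. Conjugating by [[1, x], [0, 1]]
    replaces c by c - x s and S by S + s x. If k is the first index with
    s_k != 0, then x = s_k^-1 delta_k satisfies x s = 1, and s x is the lower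
    triangular matrix with the single nonzero column s / s_k, whose only
    nonzero diagonal entry is a 1 in position k. *)
Lemma two_nil_clean_elt_bordered_strict n (c : 'M[F]_1) (r : 'rV_n) (s : 'cV_n)
    (S : 'M_n) : strictly_lower S -> two_nil_clean_elt (block_mx c r s S).
Proof.
move=> Slow; have [->|/small_shift [d dd ->]] := eqVneq c 0; last first.
  apply: two_nil_clean_elt_bordered (idempotent_elt0 _) _ => //.
  by rewrite subr0.
have [->|/cV0Pn [k0 sk0]] := eqVneq s 0.
  apply: two_nil_clean_elt_block_upper; apply: two_nil_clean_elt_nilpotent.
    exact: nilpotent_elt0.
  exact: nilpotent_strictly_lower.
pose nz := [pred k | s k 0 != 0].
case: (@arg_minnP _ k0 nz (fun k : 'I_n => k : nat) sk0) => /= k sk k_min.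
have s0 (i : 'I_n) : (i < k)%N -> s i 0 = 0.
  by rewrite ltnNge; apply: contraNeq; apply: k_min.
pose x : 'rV_n := (s k 0)^-1 *: delta_mx 0 k.
have xs : x *m s = 1.
  by apply/matrixP=> i j; rewrite !ord1 -scalemxAl -rowE !mxE mulVf.
pose P := block_mx 1 (- x) 0 1%:M; pose Q := block_mx 1 x 0 1%:M.
apply: (@two_nil_clean_elt_similar _ _ _ P Q).
- rewrite mulmx_block !(mulmx0, mul0mx, mulmx1, mul1mx, addr0, add0r) subrr.
  by rewrite -scalar_mx_block.
- rewrite mulmx_block !(mulmx0, mul0mx, mulmx1, mul1mx, addr0, add0r) addNr.
  by rewrite -scalar_mx_block.
rewrite !mulmx_block !(mulmx0, mul0mx, mulmx1, mul1mx, addr0, add0r).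
rewrite mulNmx xs.
have [d dd ->] : exists2 d : 'M[F]_1, idempotent_elt d & -1 = 1 + d.
  by apply: small_shift; rewrite oppr_eq0 matrix_nonzero1.
apply: (@two_nil_clean_elt_bordered F _ d _ _ _ (delta_mx k k)) => //.
  by rewrite /idempotent_elt -mulmxE mul_delta_mx.
move=> i j le_ij; rewrite !mxE Slow // big_ord1 !mxE addr0 /=.
have [jk|] := eqVneq j k; last by rewrite andbF !mulr0 subrr.
move: le_ij; rewrite jk leq_eqVlt => /predU1P[/val_inj->|ltik].
  by rewrite eqxx !mulr1 divff ?subrr.
by rewrite (s0 _ ltik) mul0r -val_eqE ltn_eqF // subr0.
Qed.

(** The rows of K span an A-invariant subspace. In a basis that begins with
    these rows A becomes block lower triangular with first block H, and the
    other block has a smaller size. *)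
Lemma two_nil_clean_elt_invariant m n (K : 'M[F]_(m, n)) (H : 'M_m) (A : 'M_n) :
    (0 < m)%N -> row_free K -> K *m A = H *m K -> two_nil_clean_elt H ->
    (forall n', (n' < n)%N -> two_nil_clean 'M[F]_n') ->
  two_nil_clean_elt A.
Proof.
move=> m_gt0 /eqP K_free KA H_clean IH.
have le_mn : (m <= n)%N by rewrite -K_free rank_leq_col.
pose L := row_base K^C%MS; pose P := col_mx K L; pose Q := pinvmx P.
have rL : \rank K^C = (n - m)%N by rewrite mxrank_compl K_free.
have P_full : row_full P.
  rewrite -sub1mx; apply: submx_trans (_ : K + K^C <= _)%MS.
    by rewrite sub1mx addsmx_compl_full.
  by rewrite -addsmxE addsmxS // eq_row_base.
have PQ : P *m Q = 1%:M.
  by apply: mulmxVp; rewrite /row_free (eqP P_full) rL subnKC.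
apply: (two_nil_clean_elt_similar PQ (mulVpmx P_full)).
rewrite -[P *m A *m Q]submxK.
have uPAQ : usubmx (P *m A *m Q) = row_mx H 0.
  rewrite mul_col_mx mul_col_mx col_mxKu KA -mulmxA.
  have -> : K *m Q = usubmx (P *m Q) by rewrite mul_col_mx col_mxKu.
  by rewrite PQ scalar_mx_block col_mxKu mul_mx_row mulmx1 mulmx0.
rewrite /ulsubmx /ursubmx uPAQ row_mxKl row_mxKr.
apply: two_nil_clean_elt_block_lower => //; apply: IH.
by rewrite rL -subn_gt0 subKn.
Qed.

(** The rows of B are the vectors already visited and u is the current one, so
    that B A = s u + S B with S strictly lower triangular: each visited vector
    is sent to a combination of u and of vectors visited later. The chain is
    extended by u A until its span is invariant, at which point A acts on it by
    a bordered matrix. *)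
Lemma two_nil_clean_elt_chain k n (A : 'M[F]_n) (u : 'rV_n) (B : 'M_(k, n))
    (s : 'cV_k) (S : 'M_k) :
    (forall n', (n' < n)%N -> two_nil_clean 'M[F]_n') ->
    row_free (col_mx u B) -> B *m A = s *m u + S *m B -> strictly_lower S ->
  two_nil_clean_elt A.
Proof.
move=> IH; have [d] := ubnP (n - k); elim: d => // d IHd in k u B s S *.
move=> le_d uB_free BA Slow.
have [uAK|uAnK] := boolP (u *m A <= col_mx u B)%MS.
  have [y uA] := submxP uAK.
  apply: (two_nil_clean_elt_invariant (H := block_mx (lsubmx y) (rsubmx y) s S))
    uB_free _ _ IH => //.
  - rewrite mul_block_col mul_col_mx BA uA -{1}[y]hsubmxK mul_row_col //.
  - exact: two_nil_clean_elt_bordered_strict.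
have lt_kn : (k < n)%N by rewrite -add1n -(eqP uB_free) rank_leq_col.
apply: (IHd _ (u *m A) (col_mx u B) (col_mx 1 0) (block_mx 0 0 s S)).
- by rewrite add1n subnS -ltnS prednK ?subn_gt0.
- rewrite /row_free eqn_leq rank_leq_row -{1}(eqP uB_free) add1n.
  apply: rank_ltmx; move: (col_mx u B) uAnK => K uAnK.
  by rewrite ltmxE -!addsmxE addsmxSr addsmx_sub submx_refl andbT.
- rewrite mul_block_col !mul_col_mx BA mul1mx !mul0mx addr0.
  by rewrite add_col_mx addr0 add0r.
- move=> i j; have [i1 ->|i1 ->] := split_ordP i;
    have [j1 ->|j1 ->] := split_ordP j.
  + by rewrite block_mxEul mxE.
  + by rewrite block_mxEur mxE.
  + by rewrite !ord1.
  + by rewrite block_mxEdr leq_add2l; apply: Slow.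
Qed.

Lemma two_nil_clean_mx_small_field n : two_nil_clean 'M[F]_n.
Proof.
have [N] := ubnP n; elim: N => // N IHN in n *; rewrite ltnS => le_nN A.
case: n => [|n] in le_nN A *.
  by rewrite [A]flatmx0; apply/two_nil_clean_elt_nilpotent/nilpotent_elt0.
apply: (@two_nil_clean_elt_chain 0 _ A (delta_mx 0 0) 0 0 0).
- by move=> n' lt_n'; apply: IHN; apply: leq_trans lt_n' _.
- by rewrite /row_free -addsmxE addsmx0 mxrank_delta.
- by rewrite !mul0mx addr0.
- by case.
Qed.

End SmallField.

Lemma two_nil_clean_mx_F2 n : two_nil_clean 'M['F_2]_n.
Proof.
apply: two_nil_clean_mx_small_field; case=> [[|[|m]] // lt_m].
  by apply: Or31; apply: val_inj.
by apply: Or32; apply: val_inj.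
Qed.

Lemma two_nil_clean_mx_F3 n : two_nil_clean 'M['F_3]_n.
Proof.
apply: two_nil_clean_mx_small_field; case=> [[|[|[|m]]] // lt_m].
- by apply: Or31; apply: val_inj.
- by apply: Or32; apply: val_inj.
- by apply: Or33; apply: val_inj.
Qed.

(** * Rings in which every element is a sum of two central idempotents *)

(** When c is an idempotent with c p = 0, the map k |-> c k is a non-unital ring
    morphism from F_p to T, along which decompositions can be transported. *)
Section ReductionModPrime.
Variables (T : pzRingType) (c : T) (p : nat).
Hypotheses (p_pr : prime p) (cc : idempotent_elt c) (cp : c * p%:R = 0).

Let phi (x : 'F_p) : T := c * (x : nat)%:R.

Let natr_modn m : c * (m %% p)%:R = c * m%:R.
Proof.
rewrite [in RHS](divn_eq m p) natrD natrM -commr_nat.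
by rewrite mulrDr mulrA cp mul0r add0r.
Qed.

Let phiD : {morph phi : x y / x + y}.
Proof.
move=> x y; rewrite /phi -mulrDr -natrD -[in RHS]natr_modn.
by rewrite -[X in (_ %% X)%N](Fp_cast p_pr).
Qed.

Let phiM : {morph phi : x y / x * y}.
Proof.
move=> x y; rewrite /phi mulrA -(mulrA c) -commr_nat mulrA cc -mulrA -natrM.
by rewrite -[in RHS]natr_modn -[X in (_ %% X)%N](Fp_cast p_pr).
Qed.

Lemma two_nil_clean_elt_natmx_mod n (K : 'M[nat]_n) :
    (forall m, two_nil_clean 'M['F_p]_m) ->
  two_nil_clean_elt (c%:M *m map_mx (fun k => k%:R) K).
Proof.
move=> Fp_clean.
have phi0 : phi 0 = 0 by rewrite /phi mulr0.
have -> : c%:M *m map_mx (fun k => k%:R) K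
    = map_mx phi (map_mx (fun k => k%:R : 'F_p) K).
  apply/matrixP=> i j; rewrite mul_scalar_mx !mxE /phi.
  by rewrite val_Fp_nat // natr_modn.
apply: two_nil_clean_elt_morph (Fp_clean _ _) => X Y; apply/matrixP=> i j.
  by rewrite !mxE phiD.
rewrite -!mulmxE !mxE (big_morph phi phiD phi0).
by apply: eq_bigr => k _; rewrite phiM !mxE.
Qed.

End ReductionModPrime.

Section SumsOfCentralIdempotents.
Variable T : pzRingType.
Hypothesis idemC : forall e x : T, idempotent_elt e -> GRing.comm e x.
Hypothesis sum_idem : forall x : T,
  exists e f, [/\ idempotent_elt e, idempotent_elt f & x = e + f].

(** For central idempotents e and f, the element x = e + f is a root of
    X (X - 1) (X - 2), because x^2 = x + 2 e f and e f x = 2 e f. At x = 3 this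
    reads 6 = 0. *)
Lemma six_eq0 : 6%:R = 0 :> T.
Proof.
have [e [f [ee ff]]] := sum_idem 3%:R; have ef := idemC f ee => e3.
pose g := e * f.
have g6 : 6%:R = g *+ 2.
  have : (e + f) * (e + f) = (e + f) + g *+ 2.
    rewrite mulrDl !mulrDr ee ff -ef -/g mulr2n addrACA (addrC g f).
    by rewrite -!addrA; congr (_ + _); rewrite !addrA (addrC _ f) -!addrA.
  by rewrite -e3 -natrM (natrD T 3 6) => /addrI.
have ge : g * (e + f) = g *+ 2.
  by rewrite mulrDr /g -[X in _ + X]mulrA ff ef -mulrA ee mulr2n.
have : g *+ 2 * 3%:R = g *+ 2 * 2%:R.
  by rewrite {1}e3 mulrnAl ge mulr_natr.
by rewrite -g6 -!natrM -[RHS]addr0 (natrD T 12 6) => /addrI.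
Qed.

Lemma comm_scalar_mx_central n (c : T) (A : 'M_n) :
  (forall x, GRing.comm c x) -> GRing.comm (c%:M : 'M_n) A.
Proof.
move=> cC; rewrite /GRing.comm -!mulmxE mul_scalar_mx; apply/matrixP=> i j.
rewrite !mxE (bigD1 j) //= !mxE eqxx mulr1n big1 ?addr0; first exact: cC.
by move=> k /negPf kj; rewrite mxE kj mulr0n mulr0.
Qed.

Lemma idempotent_scalar_mx n (c : T) :
  idempotent_elt c -> idempotent_elt (c%:M : 'M_n).
Proof. by move=> cc; rewrite /idempotent_elt -mulmxE -scalar_mxM cc. Qed.

Lemma two_nil_clean_mx_split n (c : T) (A A1 A2 : 'M_n) : idempotent_elt c ->
    c%:M *m A = c%:M *m A1 -> (1 - c)%:M *m A = (1 - c)%:M *m A2 ->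
  two_nil_clean_elt A1 -> two_nil_clean_elt A2 -> two_nil_clean_elt A.
Proof.
move=> cc Ac1 Ac2.
apply: (two_nil_clean_elt_split (idempotent_scalar_mx n cc)) => //.
  by move=> X; apply: comm_scalar_mx_central => x; exact: idemC.
by move: Ac2; rewrite raddfB.
Qed.

Lemma two_nil_clean_natmx n (K : 'M[nat]_n) :
  two_nil_clean_elt (map_mx (fun k => k%:R : T) K).
Proof.
have nat6 k l : (k = l %[mod 6])%N -> k%:R = l%:R :> T.
  have mod6 m : m%:R = (m %% 6)%:R :> T.
    by rewrite {1}(divn_eq m 6) natrD natrM six_eq0 mulr0 add0r.
  by move=> kl; rewrite mod6 kl -mod6.
have c3 : idempotent_elt (3%:R : T).
  by rewrite /idempotent_elt -natrM; exact: nat6.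
(* 1 - 3 = -2 is written 4, as a natural number is needed below. *)
have c4 : 1 - 3%:R = 4%:R :> T.
  by apply: (addIr 3%:R); rewrite subrK -natrD; exact: (@nat6 1 7).
set A := map_mx _ K.
apply: (@two_nil_clean_mx_split _ _ A (3%:R%:M *m A) ((1 - 3%:R)%:M *m A) c3).
- by rewrite [RHS]mulmxA -scalar_mxM c3.
- by rewrite [RHS]mulmxA -scalar_mxM (idempotent_eltC c3).
- apply: (@two_nil_clean_elt_natmx_mod T 3%:R 2) => //.
    by rewrite -natrM six_eq0.
  exact: two_nil_clean_mx_F2.
- rewrite c4; apply: (@two_nil_clean_elt_natmx_mod T 4%:R 3) => //.
  + by rewrite -c4; exact: idempotent_eltC.
  + by rewrite -natrM; exact: (@nat6 12 0).
  + exact: two_nil_clean_mx_F3.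
Qed.

Lemma two_nil_clean_mx_sum_idempotents n : two_nil_clean 'M[T]_n.
Proof.
(* s lists the entries that may still fail to be natural numbers. *)
suff nat_outside (s : seq ('I_n * 'I_n)) (A : 'M[T]_n) :
    (forall i j, (i, j) \notin s -> exists k : nat, A i j = k%:R) ->
    two_nil_clean_elt A.
  by move=> A; apply: (nat_outside (enum predT)) => i j; rewrite mem_enum.
elim: s => [|[a b] s IHs] in A *.
  move=> A_nat; have /choice[K AK] ij : exists k : nat, A ij.1 ij.2 = k%:R.
    exact: A_nat.
  have -> : A = map_mx (fun k => k%:R) (\matrix_(i, j) K (i, j)).
    by apply/matrixP=> i j; rewrite !mxE -AK.
  exact: two_nil_clean_natmx.
move=> A_nat.
pose upd x := \matrix_(i, j) if (i, j) == (a, b) then x else A i j.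
have updK : upd (A a b) = A.
  by apply/matrixP=> i j; rewrite mxE; case: eqP => // -[-> ->].
have upd_nat k : two_nil_clean_elt (upd k%:R).
  apply: IHs => i j ij_s; rewrite mxE; case: eqP => [_|/eqP ab_ij].
    by exists k.
  by apply: A_nat; rewrite inE negb_or ab_ij.
have upd_split e x x1 x2 : idempotent_elt e ->
    e * x = e * x1 -> (1 - e) * x = (1 - e) * x2 ->
    two_nil_clean_elt (upd x1) -> two_nil_clean_elt (upd x2) ->
    two_nil_clean_elt (upd x).
  move=> ee ex1 ex2; apply: (two_nil_clean_mx_split ee).
    by rewrite !mul_scalar_mx; apply/matrixP=> i j; rewrite !mxE; case: eqP.
  by rewrite !mul_scalar_mx; apply/matrixP=> i j; rewrite !mxE; case: eqP.
have idem1 (e : T) : idempotent_elt e -> (1 - e) * e = 0.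
  by move=> ee; rewrite mulrBl mul1r ee subrr.
(* On the part where e = 1 the entry x + e is x + 1, on the other part it
   is x. *)
have upd_add e x : idempotent_elt e -> two_nil_clean_elt (upd (x + 1)) ->
    two_nil_clean_elt (upd x) -> two_nil_clean_elt (upd (x + e)).
  move=> ee; apply: (upd_split e) => //.
    by rewrite !mulrDr ee mulr1.
  by rewrite mulrDr idem1 // addr0.
have [e [f [ee ff Aab]]] := sum_idem (A a b).
rewrite -updK Aab; apply: (upd_add) => //.
  rewrite addrC; apply: (upd_add) => //.
    exact: (upd_nat 2).
  exact: (upd_nat 1%N).
rewrite -[e]add0r; apply: (upd_add); rewrite ?add0r //.
  exact: (upd_nat 1%N).
exact: (upd_nat 0%N).
Qed.

End SumsOfCentralIdempotents.

(** Both e x (1 - e) and (1 - e) x e square to 0. *)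
Lemma reduced_idempotent_central (R : pzRingType) (e x : R) :
    (forall y : R, y * y = 0 -> y = 0) -> idempotent_elt e -> GRing.comm e x.
Proof.
move=> red ee.
have e1 : e * (1 - e) = 0 by rewrite mulrBr mulr1 ee subrr.
have ne : (1 - e) * e = 0 by rewrite mulrBl mul1r ee subrr.
have ex : e * x * (1 - e) = 0.
  by apply: red; rewrite !mulrA -(mulrA _ (1 - e) e) ne mulr0 !mul0r.
have xe : (1 - e) * x * e = 0.
  by apply: red; rewrite !mulrA -(mulrA _ e (1 - e)) e1 mulr0 !mul0r.
move/eqP: ex; rewrite mulrBr mulr1 subr_eq0 => /eqP ex.
move/eqP: xe; rewrite mulrBl mul1r mulrBl subr_eq0 => /eqP xe.
by rewrite /GRing.comm ex xe.
Qed.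

(** * The quotient of a ring by a two-sided ideal *)

Section IdealQuotient.
Variables (R : pzRingType) (N : set R) (idealN : two_sided_ideal N).

(** The proof that N is an ideal is an argument, so that the closure properties
    of this predicate can be inferred from its form. *)
Definition ideal_pred of two_sided_ideal N : {pred R} := fun x => `[< N x >].

Local Notation I := (ideal_pred idealN).

Lemma ideal_pred_zmod_closed : zmod_closed I.
Proof.
have [N0 NB _] := idealN.
by split=> [|x y /asboolP Nx /asboolP Ny]; apply/asboolP; [|exact: NB].
Qed.

HB.instance Definition _ := GRing.isZmodClosed.Build R I ideal_pred_zmod_closed.

Definition ideal_quotient : Type := Quotient.quot I.

HB.instance Definition _ := Choice.on ideal_quotient.
HB.instance Definition _ := EqQuotient.on ideal_quotient.
HB.instance Definition _ := GRing.Zmodule.on ideal_quotient.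

Local Notation T := ideal_quotient.

Local Open Scope quotient_scope.

Definition quot_one : T := \pi_T 1.
Definition quot_mul (s t : T) : T := \pi_T (repr s * repr t).

Lemma pi_eqP x y : \pi_T x = \pi_T y <-> N (x - y).
Proof.
split=> [/eqP|Nxy]; first by rewrite -Quotient.idealrBE => /asboolP.
by apply/eqP; rewrite -Quotient.idealrBE; apply/asboolP.
Qed.

Lemma quot_mul_pi x y : quot_mul (\pi_T x) (\pi_T y) = \pi_T (x * y).
Proof.
have [_ NB NM] := idealN; apply/pi_eqP.
set x' := repr _; set y' := repr _.
have Nx : N (x' - x) by apply/pi_eqP; rewrite reprK.
have Ny : N (y' - y) by apply/pi_eqP; rewrite reprK.
have -> : x' * y' - x * y = x' * (y' - y) - (- ((x' - x) * y)).
  by rewrite opprK mulrBr mulrBl addrA subrK.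
apply: NB; first by have [] := NM x' _ Ny.
by rewrite -mulrN; have [] := NM (- y) _ Nx.
Qed.

Lemma pi_surj (t : T) : exists x, \pi_T x = t.
Proof. by exists (repr t); exact: reprK. Qed.

Lemma quot_mulA : associative quot_mul.
Proof.
move=> r s t; have [x <-] := pi_surj r.
have [[y <-] [z <-]] := (pi_surj s, pi_surj t).
by rewrite !quot_mul_pi mulrA.
Qed.

Lemma quot_mul1l : left_id quot_one quot_mul.
Proof. by move=> t; have [x <-] := pi_surj t; rewrite quot_mul_pi mul1r. Qed.

Lemma quot_mul1r : right_id quot_one quot_mul.
Proof. by move=> t; have [x <-] := pi_surj t; rewrite quot_mul_pi mulr1. Qed.

Lemma pi_add x y : \pi_T x + \pi_T y = \pi_T (x + y).
Proof. by rewrite [RHS](@Quotient.pi_add R I). Qed.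

Lemma quot_mulDl : left_distributive quot_mul +%R.
Proof.
move=> r s t; have [x <-] := pi_surj r.
have [[y <-] [z <-]] := (pi_surj s, pi_surj t).
by rewrite pi_add !quot_mul_pi pi_add mulrDl.
Qed.

Lemma quot_mulDr : right_distributive quot_mul +%R.
Proof.
move=> r s t; have [x <-] := pi_surj r.
have [[y <-] [z <-]] := (pi_surj s, pi_surj t).
by rewrite pi_add !quot_mul_pi pi_add mulrDr.
Qed.

HB.instance Definition _ := GRing.Zmodule_isPzRing.Build T
  quot_mulA quot_mul1l quot_mul1r quot_mulDl quot_mulDr.

Definition quot_proj (x : R) : T := \pi_T x.

Lemma quot_proj_zmod_morphism : zmod_morphism quot_proj.
Proof.
move=> x y; apply: (@addIr _ (quot_proj y)); rewrite subrK.
by rewrite /quot_proj pi_add subrK.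
Qed.

Lemma quot_proj_monoid_morphism : monoid_morphism quot_proj.
Proof. by split=> // x y; rewrite /quot_proj -quot_mul_pi. Qed.

HB.instance Definition _ :=
  GRing.isZmodMorphism.Build R T quot_proj quot_proj_zmod_morphism.
HB.instance Definition _ :=
  GRing.isMonoidMorphism.Build R T quot_proj quot_proj_monoid_morphism.

Lemma quot_proj_eq0 x : quot_proj x = 0 <-> N x.
Proof.
by rewrite -(rmorph0 quot_proj) pi_eqP subr0.
Qed.

End IdealQuotient.

(** * Matrices over the prime radical *)

Lemma two_sided_ideal0 (R : pzRingType) : two_sided_ideal [set (0 : R)].
Proof.
by split=> [//|x y -> ->|r x ->]; rewrite ?mulr0 ?mul0r ?subrr.
Qed.

Lemma prime_radical_ideal (R : pzRingType) : two_sided_ideal (prime_radical R).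
Proof.
split=> [P [[]] //|x y Px Py P P_prime|r x Px].
  by have [[_ PB _] _ _] := P_prime; apply: PB; [exact: Px|exact: Py].
by split=> P P_prime; have [[_ _ PM] _ _] := P_prime;
  have [] := PM r x (Px P P_prime).
Qed.

Definition sum_ideal (R : pzRingType) (I J : set R) : set R := 
  [set x | exists a b, [/\ I a, J b & x = a + b]].

Lemma chain_bigcup_seq (T : eqType) (F : set (set T)) (s : seq T) :
    total_on F subset -> F !=set0 ->
    (forall x, x \in s -> (\bigcup_(X in F) X) x) ->
  exists2 X, F X & forall x, x \in s -> X x.
Proof.
move=> F_chain [X0 FX0]; elim: s => [|x s IHs] sF; first by exists X0.
have [X FX sX] : exists2 X, F X & forall x, x \in s -> X x.
  by apply: IHs => y ys; apply: sF; rewrite inE ys orbT.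
have [Y FY Yx] := sF x (mem_head x s).
have [XY|YX] := F_chain X Y FX FY; [exists Y | exists X] => // y;
  rewrite inE => /predU1P[->|/sX] //.
- exact: XY.
- exact: YX.
Qed.

Lemma two_sided_ideal_chain (R : pzRingType) (F : set (set R)) :
    total_on F subset -> F !=set0 ->
    (forall X, F X -> X = set0 \/ two_sided_ideal X) ->
  \bigcup_(X in F) X = set0 \/ two_sided_ideal (\bigcup_(X in F) X).
Proof.
move=> F_chain F0 F_ideal.
have idF X x : F X -> X x -> two_sided_ideal X.
  by move=> FX Xx; have [X0|//] := F_ideal X FX; rewrite X0 in Xx.
have [->|/eqP/set0P[x0 [X0 FX0 X0x0]]] := EM (\bigcup_(X in F) X = set0).
  by left.
right; split.
- by exists X0 => //; have [] := idF X0 x0 FX0 X0x0.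
- move=> x y Ux Uy.
  have [X FX sX] : exists2 X, F X & forall z, z \in [:: x; y] -> X z.
    by apply: chain_bigcup_seq => // z; rewrite !inE => /orP[]/eqP->.
  have Xx : X x by apply: sX; rewrite mem_head.
  have [_ XB _] := idF X x FX Xx; exists X => //; apply: XB => //.
  by apply: sX; rewrite !inE eqxx orbT.
- move=> r x [X FX Xx]; have [_ _ /(_ r x Xx)[rx xr]] := idF X x FX Xx.
  by split; exists X.
Qed.

Section MatrixOverPrimeRadical.
Variables (R : pzRingType) (n : nat) (W : 'M[R]_n).
Hypothesis W_rad : forall i j, prime_radical R (W i j).

Let entries_in (I : set R) (A : 'M_n) := forall i j, I (A i j).

Let avoids (I : set R) := forall k, ~ entries_in I (W ^+ k).

Let entries_inM (I J K : set R) (A B : 'M_n) : two_sided_ideal K ->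
    (forall a b, I a -> J b -> K (a * b)) ->
  entries_in I A -> entries_in J B -> entries_in K (A * B).
Proof.
move=> [K0 KB _] IJK IA JB i j; rewrite -mulmxE mxE.
apply: (big_ind K) => // [x y Kx Ky|k _]; last exact: IJK.
by rewrite -[y]opprK; apply: (KB) => //; rewrite -sub0r; apply: (KB).
Qed.

Let sum_ideal_ideal (I J : set R) : two_sided_ideal I -> two_sided_ideal J ->
  two_sided_ideal (sum_ideal I J).
Proof.
move=> [I0 IB IM] [J0 JB JM]; split.
- by exists 0, 0; rewrite addr0.
- move=> _ _ [a [b [Ia Jb ->]]] [a' [b' [Ia' Jb' ->]]].
  exists (a - a'), (b - b'); rewrite opprD addrACA.
  by split; [exact: IB|exact: JB|].
- move=> r _ [a [b [Ia Jb ->]]].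
  have [[ra ar] [rb br]] := (IM r a Ia, JM r b Jb).
  split; [exists (r * a), (r * b)|exists (a * r), (b * r)];
    by rewrite ?mulrDr ?mulrDl.
Qed.

(** If A and B are ideals not contained in I, then I + A and I + B contain the
    entries of W^k and of W^l for some k and l, so that the entries of
    W^(k + l) lie in (I + A) (I + B), which is contained in I as soon as A B
    is. *)
Let maximal_avoiding_prime (I : set R) : two_sided_ideal I -> avoids I ->
    (forall J, two_sided_ideal J -> (I `<` J)%classic -> ~ avoids J) ->
  prime_ideal I.
Proof.
move=> idI I_avoids I_max; have [I0 IB IM] := idI; split=> //.
  by move=> IT; apply: (I_avoids 0%N) => i j; rewrite IT.
move=> A B idA idB AB; apply: contrapT => /not_orP[].
move=> /nonsubset[a [Aa nIa]] /nonsubset[b [Bb nIb]].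
have grow (C : set R) c : two_sided_ideal C -> C c -> ~ I c ->
    exists k, entries_in (sum_ideal I C) (W ^+ k).
  move=> idC Cc nIc; apply: contrapT => no_pow.
  apply: (I_max (sum_ideal I C)); first exact: sum_ideal_ideal.
    have [C0 _ _] := idC; split=> [x Ix|sub].
      by exists x, 0; rewrite addr0.
    by apply: nIc; apply: sub; exists 0, c; rewrite add0r.
  by move=> k Wk; apply: no_pow; exists k.
have [k Wk] := grow A a idA Aa nIa; have [l Wl] := grow B b idB Bb nIb.
apply: (I_avoids (k + l)%N); rewrite exprD.
apply: (entries_inM idI _ Wk Wl).
move=> _ _ [x [a' [Ix Aa' ->]]] [y [b' [Iy Bb' ->]]].
have ID u v : I u -> I v -> I (u + v).
  move=> Iu Iv; rewrite -[v]opprK; apply: (IB) => //.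
  by rewrite -sub0r; apply: (IB).
rewrite mulrDr !mulrDl; apply: (ID); apply: (ID).
- by have [] := IM y x Ix.
- by have [] := IM a' y Iy.
- by have [] := IM b' x Ix.
- by apply: AB; exists a' => //; exists b'.
Qed.

Lemma nilpotent_mx_prime_radical : nilpotent_elt W.
Proof.
apply: contrapT => W_nonnil.
have avoids0 : avoids [set 0].
  move=> k Wk; apply: W_nonnil; exists k.
  by apply/matrixP=> i j; rewrite Wk mxE.
(* The empty set bounds the empty chain. It is not maximal in Z, since the zero
   ideal avoids the powers of W. *)
pose Z (I : set R) := I = set0 \/ two_sided_ideal I /\ avoids I.
have [I [ZI I_max]] : exists I, Z I /\ (forall J, (I `<` J)%classic -> ~ Z J).
  apply: Zorn_bigcup => F FZ F_chain.
  have [F0|F0] := pselect (F !=set0); last first.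
    left; rewrite bigcup0 // => X FX; case: F0; by exists X.
  have F_ideal X : F X -> X = set0 \/ two_sided_ideal X.
    by move=> /FZ[|[]]; [left|right].
  have [->|idU] := two_sided_ideal_chain F_chain F0 F_ideal; [by left|right].
  split=> // k Wk.
  (* The finitely many entries of W ^+ k lie in a single member X of the chain.
     Listing 0 with them ensures that X is not empty, also when n = 0. *)
  pose s := [seq (W ^+ k) ij.1 ij.2 | ij : 'I_n * 'I_n].
  have [X FX sX] : exists2 X, F X & forall x, x \in 0 :: s -> X x.
    apply: chain_bigcup_seq => // x; rewrite inE => /predU1P[->|/mapP[ij _ ->]].
      by have [] := idU.
    exact: Wk.
  have [X0|[_ X_avoids]] := FZ X FX.
    by have := sX 0 (mem_head _ _); rewrite X0.
  apply: (X_avoids k) => i j; apply: sX; rewrite inE; apply/orP; right.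
  by apply/mapP; exists (i, j); rewrite ?mem_enum.
have [I_0|[idI I_avoids]] := ZI.
  apply: (I_max [set 0] _); last by right; split=> //; exact: two_sided_ideal0.
  by rewrite I_0; split=> // /(_ 0); apply.
have I_prime : prime_ideal I.
  apply: maximal_avoiding_prime => // J idJ IJ avJ.
  by apply: (I_max J) => //; right.
by apply: (I_avoids 1%N) => i j; rewrite expr1; apply: W_rad.
Qed.

End MatrixOverPrimeRadical.

(** * The theorem *)

Theorem theorem3p3 (R : pzRingType) (R_2primal : two_primal R)
    (R_clean : strongly_two_nil_clean R) (n : nat) (n_gt0 : (0 < n)%N) :
  two_nil_clean 'M[R]_n.
Proof.
have idP := prime_radical_ideal R; pose T := ideal_quotient idP.
pose h : {rmorphism R -> T} := quot_proj idP.
have h_surj t : exists x, h x = t by exact: pi_surj.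
have h0 x : h x = 0 <-> nilpotent_elt x.
  by rewrite quot_proj_eq0 R_2primal.
have T_reduced (t : T) : t * t = 0 -> t = 0.
  have [x <-] := h_surj t; rewrite -rmorphM h0 => -[k xk]; apply/h0.
  by exists (2 * k)%N; rewrite exprM expr2.
apply: (two_nil_clean_lift (h := map_mx h)).
- move=> X hX; apply: nilpotent_mx_prime_radical => i j; rewrite R_2primal.
  by apply/h0; move/matrixP: hX => /(_ i j); rewrite !mxE.
- move=> Y; have /choice[g hg] := h_surj; exists (map_mx g Y).
  by apply/matrixP=> i j; rewrite !mxE.
apply: two_nil_clean_mx_sum_idempotents => [e x ee|t].
  exact: reduced_idempotent_central.
have [x <-] := h_surj t; have [e [f [w [[ee ff ww ->] _]]]] := R_clean x.
exists (h e), (h f); rewrite !rmorphD (h0 w).2 // addr0.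
by split=> //; apply: idempotent_elt_morph => //; exact: rmorphM.
Qed.
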